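(* Let $N$ be a positive integer, let $\{\varepsilon_k\}_{k\ge 1}$ be a sequence of nonzero real numbers with $\varepsilon_k\to 0$, and for each $k$ let $(q_0^k,\dots,q_N^k)$ be a relative equilibrium (with rotation rate $\omega=1$) of the $(N+1)$-vortex problem with circulations $\Gamma_0=1$, $\Gamma_1=\dots=\Gamma_N=\varepsilon_k$, with center of vorticity at the origin, such that for some constants $m,M>0$ independent of $k$ all mutual distances $|q_i^k-q_j^k|$ ($i\ne j$) are at least $m$ and all $|q_j^k|\le M$. Suppose that $(q_0^k,\dots,q_N^k)$ converges as $k\to\infty$ to a configuration $(q_0,\dots,q_N)$ (i.e. to a relative equilibrium of the $(1+N)$-vortex problem). Then, as $k\to\infty$, $$|q_0^k|=\mathcal{O}(\varepsilon_k),\qquad |q_j^k|^2-1=\mathcal{O}(\varepsilon_k),\quad j=1,\dots,N.$$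
   Context: For $(x,y)\in\mathbb{R}^2$ write $(x,y)^\perp=(-y,x)$. The $(N+1)$-vortex problem with circulations $\Gamma_0,\dots,\Gamma_N\in\mathbb{R}$ is the system for $q_0,\dots,q_N\in\mathbb{R}^2$ (pairwise distinct) $$\dot q_j=\sum_{i=0,\,i\ne j}^N \Gamma_i\frac{(q_j-q_i)^\perp}{|q_j-q_i|^2},\qquad j=0,\dots,N.$$ Here $\Gamma_0=1$ and $\Gamma_1=\dots=\Gamma_N=\varepsilon$, where $\varepsilon$ may be positive or negative. A configuration is a relative equilibrium with rotation rate $\omega=1$ if it is a fixed point in the frame rotating rigidly about the origin at rate $1$, i.e. $q_j^\perp=\sum_{i\ne j}\Gamma_i\frac{(q_j-q_i)^\perp}{|q_j-q_i|^2}$ for $j=0,\dots,N$. The center of vorticity being at the origin means $q_0+\varepsilon(q_1+\dots+q_N)=0$. A relative equilibrium of the $(1+N)$-vortex problem is by definition a limit of such relative equilibria of the $(N+1)$-vortex problem along a sequence $\varepsilon_k\to0$. Here $a_k=\mathcal{O}(\varepsilon_k)$ means $|a_k|\le C|\varepsilon_k|$ for all sufficiently large $k$, with $C$ independent of $k$. *)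

(* Defs.v *)
From HB Require Import structures.
From mathcomp Require Import all_boot all_order all_algebra.
From mathcomp Require Import all_classical all_reals all_analysis.
Set Implicit Arguments.
Unset Strict Implicit.
Unset Printing Implicit Defensive.
Import Order.TTheory GRing.Theory Num.Theory.
Import numFieldNormedType.Exports.
Local Open Scope ring_scope.

(* The plane is 'rV[R]_2, with columns 0 and 1 for the x and y coordinates. *)

(* The library norm `|u| on 'rV[R]_2 is the sup norm, so the Euclidean norm is
   defined here; both induce the same topology. *)
Definition enorm {R : realType} (u : 'rV[R]_2) : R :=
  Num.sqrt (u 0 0 ^+ 2 + u 0 1 ^+ 2).

Definition perp {R : realType} (u : 'rV[R]_2) : 'rV[R]_2 :=
  \row_(c < 2) if c == 0 then - u 0 1 else u 0 0.

Definition vortex_velocity {R : realType} {n : nat} (Gamma : 'I_n -> R)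
    (q : 'I_n -> 'rV[R]_2) (j : 'I_n) : 'rV[R]_2 :=
  \sum_(i < n | i != j)
    (Gamma i / enorm (q j - q i) ^+ 2) *: perp (q j - q i).

(* The distinctness of the positions is part of the n-vortex problem: it keeps
   every denominator in vortex_velocity nonzero. *)
Definition relative_equilibrium {R : realType} {n : nat} (Gamma : 'I_n -> R)
    (omega : R) (q : 'I_n -> 'rV[R]_2) : Prop :=
  injective q /\ forall j, omega *: perp (q j) = vortex_velocity Gamma q j.

(* Index 0 is the strong vortex, indices 1, ..., N are the weak ones. *)
Definition circulation {R : realType} {N : nat} (eps : R) (i : 'I_N.+1) : R :=
  if i == ord0 then 1 else eps.

Definition centered {R : realType} {N : nat} (eps : R)
    (q : 'I_N.+1 -> 'rV[R]_2) : Prop :=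
  q ord0 + eps *: (\sum_(j < N) q (lift ord0 j)) = 0.

(* Main.v *)
Require Import Defs.
From mathcomp Require Import all_boot all_order all_algebra.
From mathcomp Require Import all_classical all_reals all_analysis.
From mathcomp Require Import ring.
Import Order.TTheory GRing.Theory Num.Theory.
Import numFieldNormedType.Exports.
Local Open Scope classical_set_scope.
Local Open Scope ring_scope.

(** Both estimates are proved for one configuration at a time, with constants
that depend only on [N], [m] and [M]; this makes them uniform in [k].

The center of vorticity gives [q_0 = - eps (q_1 + ... + q_N)], hence
[|q_0| <= N M |eps|] ([strong_vortex_bound]).

For a weak vortex [j], put [p := q_j - q_0] and take the inner product of its
equation with [p^perp]. Since the quarter turn is an isometry and the strong
vortex contributes [<p, p> / |p|^2 = 1], what remains is
[<q_j, q_j - q_0> = 1 + eps S], where [S] is the sum of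
[<q_j - q_i, p> / |q_j - q_i|^2] over the other weak vortices. Thus
[|q_j|^2 - 1 = <q_j, q_0> + eps S] ([weak_vortex_identity]): the first term is
[O(eps)] by the estimate on [q_0], and [S] is bounded because the mutual
distances are bounded below ([weak_vortex_bound]). *)

(** * The Euclidean inner product on the plane *)

Definition dotp {R : realType} (u v : 'rV[R]_2) : R :=
  u 0 0 * v 0 0 + u 0 1 * v 0 1.

Section InnerProduct.
Context {R : realType}.
Implicit Types (u v w : 'rV[R]_2) (a : R).

Lemma enorm_ge0 u : 0 <= enorm u.
Proof. exact: sqrtr_ge0. Qed.

Lemma sqr_enorm u : enorm u ^+ 2 = dotp u u.
Proof. by rewrite /enorm sqr_sqrtr ?addr_ge0 ?sqr_ge0 // /dotp !expr2. Qed.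

Lemma dotpDl u v w : dotp (u + v) w = dotp u w + dotp v w.
Proof. by rewrite /dotp !mxE; ring. Qed.

Lemma dotpZl a u v : dotp (a *: u) v = a * dotp u v.
Proof. by rewrite /dotp !mxE; ring. Qed.

Lemma dot0p v : dotp 0 v = 0.
Proof. by rewrite /dotp !mxE; ring. Qed.

Lemma dotpBr u v w : dotp u (v - w) = dotp u v - dotp u w.
Proof. by rewrite /dotp !mxE; ring. Qed.

Lemma dotp_suml (I : finType) (P : pred I) (F : I -> 'rV[R]_2) v :
  dotp (\sum_(i | P i) F i) v = \sum_(i | P i) dotp (F i) v.
Proof.
exact: (big_morph (dotp^~ v) (fun u w => dotpDl u w v) (dot0p v)).
Qed.

(** The quarter turn is an isometry, so pairing the vortex equation with
[perp p] removes every [perp] from it. *)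
Lemma dotp_perp u v : dotp (perp u) (perp v) = dotp u v.
Proof. by rewrite /dotp !mxE /=; ring. Qed.

Lemma normr_dotp_le u v : `|dotp u v| <= enorm u * enorm v.
Proof.
rewrite -(@ler_pXn2r _ 2) // ?nnegrE ?normr_ge0 ?mulr_ge0 ?enorm_ge0 //.
rewrite real_normK ?num_real // exprMn !sqr_enorm -subr_ge0.
(* Lagrange's identity: the defect is the square of the determinant. *)
rewrite [leRHS](_ : _ = (u 0 0 * v 0 1 - u 0 1 * v 0 0) ^+ 2) ?sqr_ge0 //.
by rewrite /dotp; ring.
Qed.

Lemma enorm_gt0 u : u != 0 -> 0 < enorm u.
Proof.
move=> u_neq0; rewrite lt_neqAle enorm_ge0 andbT eq_sym.
apply: contra_neq u_neq0 => u0; have /eqP := sqr_enorm u.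
rewrite u0 expr0n eq_sym /dotp -!expr2 paddr_eq0 ?sqr_ge0 //.
rewrite !sqrf_eq0 => /andP[/eqP u00 /eqP u01].
apply/rowP => -[[|[|//]] lt_i]; rewrite mxE.
  by rewrite -[RHS]u00; congr (u _ _); apply: val_inj.
by rewrite -[RHS]u01; congr (u _ _); apply: val_inj.
Qed.

(** Taking [v := u] in the hypothesis gives [|u|^2 <= C |u|]. The point is to
turn an estimate on a sum of vectors into one on a sum of scalars. *)
Lemma enorm_le_dual u (C : R) : 0 <= C ->
  (forall v, `|dotp u v| <= C * enorm v) -> enorm u <= C.
Proof.
move=> C_ge0 /(_ u); rewrite -sqr_enorm ger0_norm ?sqr_ge0 // expr2.
have := enorm_ge0 u; rewrite le_eqVlt => /predU1P[<- //|u_gt0].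
by rewrite ler_pM2r.
Qed.

End InnerProduct.

Lemma ler_norm_sum_const (R : numDomainType) (n : nat) (P : pred 'I_n)
    (F : 'I_n -> R) (C : R) : 0 <= C -> (forall i, P i -> `|F i| <= C) ->
  `|\sum_(i | P i) F i| <= n%:R * C.
Proof.
move=> C_ge0 leFC; rewrite big_mkcond; apply: le_trans (ler_norm_sum _ _ _) _.
rewrite mulr_natl -[in leRHS](card_ord n) -sumr_const.
apply: ler_sum => i _; case: ifPn => [/leFC //|_]; by rewrite normr0.
Qed.

(** * Estimates for a single configuration *)

Section Configuration.
Context {R : realType} {N : nat} {eps : R} {q : 'I_N.+1 -> 'rV[R]_2}.
Hypotheses (q_eq : relative_equilibrium (circulation eps) 1 q)
  (q_ctr : centered eps q).
Context {m M : R}.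
Hypotheses (m_gt0 : 0 < m) (M_ge0 : 0 <= M)
  (q_sep : forall i j, i != j -> m <= enorm (q i - q j))
  (q_bnd : forall j, enorm (q j) <= M).

Lemma strong_vortex_bound : enorm (q ord0) <= N%:R * M * `|eps|.
Proof.
apply: enorm_le_dual => [|v]; first by rewrite !mulr_ge0.
have -> : q ord0 = (- eps) *: \sum_(j < N) q (lift ord0 j).
  by move/eqP: q_ctr; rewrite addr_eq0 scaleNr => /eqP.
rewrite dotpZl dotp_suml normrM normrN [leRHS]mulrAC mulrC ler_wpM2r //.
rewrite -mulrA; apply: ler_norm_sum_const => [|i _].
  by rewrite mulr_ge0 ?enorm_ge0.
by apply: le_trans (normr_dotp_le _ _) _; rewrite ler_wpM2r ?enorm_ge0.
Qed.

(** This is the equation of the weak vortex [j] paired with [perp p], where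
[p := q_j - q_0]: the velocity induced by the strong vortex is [p / |p|^2] up
to a quarter turn, so its pairing is exactly [1], whatever the distance
[|p|]. *)
Lemma weak_vortex_identity (j : 'I_N.+1) : j != ord0 ->
  enorm (q j) ^+ 2 - 1 = dotp (q j) (q ord0) +
    eps * \sum_(i | (i != j) && (i != ord0))
            dotp (q j - q i) (q j - q ord0) / enorm (q j - q i) ^+ 2.
Proof.
move=> j_neq0; have [q_inj /(_ j)] := q_eq.
rewrite scale1r => /(congr1 (fun u => dotp u (perp (q j - q ord0)))).
rewrite dotp_perp dotpBr -sqr_enorm /vortex_velocity dotp_suml.
rewrite (bigD1 ord0) /=; last by rewrite eq_sym.
rewrite dotpZl dotp_perp -sqr_enorm {1}/circulation eqxx mulfVK; last first.
  rewrite expf_neq0 // gt_eqF // enorm_gt0 // subr_eq0.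
  by apply: contra_neq j_neq0 => /q_inj.
under eq_bigr => i /andP[_ /negbTE i0].
  rewrite dotpZl dotp_perp /circulation i0 mulrAC -mulrA; over.
by rewrite -mulr_sumr => /eqP; rewrite subr_eq => /eqP ->; ring.
Qed.

(** Each summand of [weak_vortex_identity] is at most [|p| / |q_j - q_i|] in
absolute value, and [|p| <= M + M]; the factor [N.+1] is a crude count of
these summands. *)
Lemma weak_vortex_bound (j : 'I_N.+1) : j != ord0 ->
  `|enorm (q j) ^+ 2 - 1| <=
    (M * (N%:R * M) + N.+1%:R * ((M + M) / m)) * `|eps|.
Proof.
move=> j_neq0; rewrite weak_vortex_identity // mulrDl.
apply: le_trans (ler_normD _ _) _; apply: lerD.
  apply: le_trans (normr_dotp_le _ _) _; rewrite -mulrA.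
  by apply: ler_pM (q_bnd j) strong_vortex_bound; rewrite enorm_ge0.
rewrite normrM [leRHS]mulrC ler_wpM2l //.
apply: ler_norm_sum_const => [|i /andP[ij _]].
  by rewrite divr_ge0 ?addr_ge0 // ltW.
have w_ge : m <= enorm (q j - q i) by apply: q_sep; rewrite eq_sym.
have w_gt0 := lt_le_trans m_gt0 w_ge.
(* One of the two factors [|q_j - q_i|] in the denominator is used up by the
   Cauchy-Schwarz inequality; the other one is at least [m]. *)
have dot_le : `|dotp (q j - q i) (q j - q ord0)| <=
    (M + M) * enorm (q j - q i).
  rewrite dotpBr mulrDl [M * _]mulrC.
  apply: le_trans (ler_normB _ _) _; apply: lerD;
    apply: le_trans (normr_dotp_le _ _) _;
    by rewrite ler_wpM2l ?enorm_ge0.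
rewrite normrM normfV (ger0_norm (sqr_ge0 _)) ler_pdivrMr ?exprn_gt0 //.
apply: le_trans dot_le _; rewrite expr2 mulrA ler_wpM2r ?enorm_ge0 //.
by rewrite -mulrA ler_peMr ?addr_ge0 // mulrC ler_pdivlMr // mul1r.
Qed.

End Configuration.

(** * Uniformity along the sequence *)

Lemma eqO_of_le (R : realType) (f g : nat -> R) (C : R) :
  (forall k, `|f k| <= C * `|g k|) ->
  (f : nat -> R^o) =O_\oo (g : nat -> R^o).
Proof.
move=> le_fg; apply/eqO_exP; exists (Num.max C 1).
  by rewrite lt_max ltr01 orbT.
apply: nearW => k; apply: le_trans (le_fg k) _.
by rewrite ler_wpM2r // le_max lexx.
Qed.

Theorem lemma1 (R : realType) (N : nat) (N_gt0 : (0 < N)%N)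
    (eps : nat -> R) (eps_neq0 : forall k, eps k != 0)
    (eps_cvg0 : eps k @[k --> \oo] --> (0 : R))
    (q : nat -> 'I_N.+1 -> 'rV[R]_2)
    (q_releq : forall k, relative_equilibrium (circulation (eps k)) 1 (q k))
    (q_centered : forall k, centered (eps k) (q k))
    (m M : R) (m_gt0 : 0 < m) (M_gt0 : 0 < M)
    (q_separated : forall k i j, i != j -> m <= enorm (q k i - q k j))
    (q_bounded : forall k j, enorm (q k j) <= M)
    (qlim : 'I_N.+1 -> 'rV[R]_2)
    (q_cvg : forall j, q k j @[k --> \oo] --> qlim j) :
  (fun k => enorm (q k ord0) : R^o) =O_\oo (eps : nat -> R^o) /\
  forall j : 'I_N.+1, j != ord0 ->
    (fun k => enorm (q k j) ^+ 2 - 1 : R^o) =O_\oo (eps : nat -> R^o).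
Proof.
have M_ge0 := ltW M_gt0; split=> [|j j_neq0].
  apply: (@eqO_of_le _ _ _ (N%:R * M)) => k.
  by rewrite (ger0_norm (enorm_ge0 _)); apply: strong_vortex_bound.
apply: (@eqO_of_le _ _ _ (M * (N%:R * M) + N.+1%:R * ((M + M) / m))) => k.
exact: (weak_vortex_bound (q_releq k) (q_centered k) m_gt0 M_ge0
  (q_separated k) (q_bounded k) _ j_neq0).
Qed.
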